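(* Let the joint law $P$ of $(Y,\lambda)\in\{-1,1\}\times\{-1,1\}^m$ be the Ising model $$P(Y,\lambda)=\frac1Z\exp\Big(\theta_Y Y+\sum_{i=1}^m\theta_i\lambda_iY+\sum_{(i,j)\in E_\lambda}\theta_{ij}\lambda_i\lambda_j\Big),$$ where $Z$ is the normalizing constant, all canonical parameters are nonnegative, and $E_\lambda$ is a set of unordered pairs of distinct sources in which each source belongs to at most one pair. Suppose a random training dataset $\mathcal N$ (with possible additional algorithmic randomness $\tau$) is used to produce estimated conditional distributions $\tilde P(\lambda_i=\cdot\mid Y=y)$ for $i\in[m]$ and $y\in\{\pm1\}$. Let $\hat P$ denote the empirical distribution of the source vectors in $\mathcal N$. Define $$\tilde P(Y=y\mid\lambda=s)=\frac{\prod_{i=1}^m\tilde P(\lambda_i=s_i\mid Y=y)\,P(Y=y)}{\hat P(\lambda=s)},$$ where $P(Y=y)$ is the true class balance. Then the generalization error satisfies $$\mathbb E[l(\tilde Y,Y)]=H(Y\mid\lambda)-\mathbb E_{\mathcal N}\big[D_{\mathrm{KL}}(P(\lambda)\,\|\,\hat P(\lambda))\big]+\sum_{(i,j)\in E_\lambda}I(\lambda_i;\lambda_j\mid Y)+\sum_{i=1}^m\mathbb E_{Y,\mathcal N,\tau}\big[D_{\mathrm{KL}}(P_{\lambda_i\mid Y}\,\|\,\tilde P_{\lambda_i\mid Y})\big].$$ Here: - $H(Y\mid\lambda)$ is the conditional entropy under $P$; - $I(\lambda_i;\lambda_j\mid Y)$ is the conditional mutual information under $P$; - $\mathbb E_Y[D_{\mathrm{KL}}(P_{\lambda_i\mid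 Y}\|\tilde P_{\lambda_i\mid Y})]=\sum_{y}P(Y=y)\sum_{s\in\{\pm1\}}P(\lambda_i=s\mid Y=y)\log\frac{P(\lambda_i=s\mid Y=y)}{\tilde P(\lambda_i=s\mid Y=y)}$.
   Context: The loss is the cross-entropy $$l(\tilde Y,Y)=-\frac{1+Y}{2}\log\tilde P(Y=1\mid\lambda)-\frac{1-Y}{2}\log\tilde P(Y=-1\mid\lambda).$$ The expectation $\mathbb E[l(\tilde Y,Y)]$ is taken over: - a fresh pair $(Y,\lambda)\sim P$, independent of the data; - the dataset $\mathcal N$; - the algorithmic randomness $\tau$. Given the dependency structure (each source in at most one pair of $E_\lambda$), the true conditional law factorizes as $P(\lambda\mid Y)=\prod_{(i,j)\in E_\lambda}P(\lambda_i,\lambda_j\mid Y)\prod_{i\text{ in no pair}}P(\lambda_i\mid Y)$.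
   Formalization: The formal statement assumes that for every outcome the empirical probability of each source vector and every estimated conditional probability are strictly positive, since otherwise the definition divides by zero or the loss takes log 0; it also assumes measurability of the data and estimates. *)

(* Defs.v *)
From HB Require Import structures.
From mathcomp Require Import all_boot all_order all_algebra.
From mathcomp Require Import all_classical all_reals all_analysis.
Set Implicit Arguments. Unset Strict Implicit. Unset Printing Implicit Defensive.
Import Order.TTheory GRing.Theory Num.Theory.
Local Open Scope ring_scope.

(* Labels and source outputs in {-1,1} are encoded by booleans:
   true <-> +1, false <-> -1. *)
Definition sg {R : realType} (b : bool) : R := if b then 1 else -1.

Definition SV (m : nat) := {ffun 'I_m -> bool}.

Section Ising.
Variables (R : realType) (m : nat).
(* Parameters: thetaY, theta_i, theta_ij; E is a set of pairs (i,j) with i<j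
   representing unordered pairs {i,j} of distinct sources. *)
Variables (thY : R) (th : 'I_m -> R) (th2 : 'I_m -> 'I_m -> R)
          (E : {set 'I_m * 'I_m}).

Definition ising_weight (y : bool) (s : SV m) : R :=
  expR (thY * sg y + \sum_(i < m) th i * sg (s i) * sg y
        + \sum_(e in E) th2 e.1 e.2 * sg (s e.1) * sg (s e.2)).

Definition ising_Z : R := \sum_(y : bool) \sum_(s : SV m) ising_weight y s.

Definition PJ (y : bool) (s : SV m) : R := ising_weight y s / ising_Z.

Definition PY (y : bool) : R := \sum_(s : SV m) PJ y s.

Definition Plam (s : SV m) : R := \sum_(y : bool) PJ y s.

Definition Pcond1 (i : 'I_m) (y a : bool) : R :=
  (\sum_(s : SV m | s i == a) PJ y s) / PY y.

Definition Pcond2 (i j : 'I_m) (y a b : bool) : R :=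
  (\sum_(s : SV m | (s i == a) && (s j == b)) PJ y s) / PY y.

Definition condH : R :=
  - \sum_(y : bool) \sum_(s : SV m) PJ y s * ln (PJ y s / Plam s).

Definition condMI (i j : 'I_m) : R :=
  \sum_(y : bool) PY y * \sum_(a : bool) \sum_(b : bool)
     Pcond2 i j y a b * ln (Pcond2 i j y a b / (Pcond1 i y a * Pcond1 j y b)).

Definition Phat (n : nat) (data : n.-tuple (SV m)) (s : SV m) : R :=
  (count_mem s data)%:R / n%:R.

Definition Ptil_post (Ptil : 'I_m -> bool -> bool -> R) (Ph : SV m -> R)
    (y : bool) (s : SV m) : R :=
  (\prod_(i < m) Ptil i y (s i)) * PY y / Ph s.

Definition xent_loss (Ptil : 'I_m -> bool -> bool -> R) (Ph : SV m -> R)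
    (y : bool) (s : SV m) : R :=
  - ((1 + sg y) / 2) * ln (Ptil_post Ptil Ph true s)
  - ((1 - sg y) / 2) * ln (Ptil_post Ptil Ph false s).

Definition exp_loss (Ptil : 'I_m -> bool -> bool -> R) (Ph : SV m -> R) : R :=
  \sum_(y : bool) \sum_(s : SV m) PJ y s * xent_loss Ptil Ph y s.

Definition KL_lam (Ph : SV m -> R) : R :=
  \sum_(s : SV m) Plam s * ln (Plam s / Ph s).

Definition KL_src (Ptil : 'I_m -> bool -> bool -> R) (i : 'I_m) : R :=
  \sum_(y : bool) PY y * \sum_(a : bool)
     Pcond1 i y a * ln (Pcond1 i y a / Ptil i y a).

End Ising.

Arguments Phat R {m n} data s.

(* Main.v *)
Require Import Defs.
From HB Require Import structures.
From mathcomp Require Import all_boot all_order all_algebra.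
From mathcomp Require Import all_classical all_reals all_analysis.
From mathcomp Require Import measurable_realfun ring lra.
Set Implicit Arguments.
Import Order.TTheory GRing.Theory Num.Theory.
Local Open Scope ring_scope.

(* Given Y = y the weight of the Ising model is a product over the sources times
   a product over the disjoint pairs, so P(s | y) is the product of the marginals
   of the unpaired sources and of the pair marginals.  Equivalently it is the
   product of all single-source marginals times one factor
   P(s_i, s_j | y) / (P(s_i | y) P(s_j | y)) per pair.  Taking logarithms, the
   loss at (y, s) is
     - ln P(y | s) - ln (P(s) / Phat(s)) + (sum over pairs) + (sum over sources),
   and averaging over (y, s) gives the identity for each outcome of the data.
   The Kullback-Leibler terms of the sources are nonnegative but may have
   infinite expectation; the remaining part takes finitely many values. *)

Lemma sumr_gt0 {R : numDomainType} (T : finType) (P : pred T) (F : T -> R) (x : T) :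
  P x -> (forall t, 0 < F t) -> 0 < \sum_(t | P t) F t.
Proof.
move=> Px F0; rewrite (bigD1 x)//= ltr_wpDr// sumr_ge0// => t _.
exact: ltW.
Qed.

(** * Pairwise models whose edges form a matching *)

Section PairwiseModel.
Context {R : realFieldType} {I T : finType}.
Implicit Types (E F : {set I * I}) (e : I * I) (i j : I) (a b : T).
Implicit Types (f : I -> T -> R) (g : I * I -> T -> T -> R).

Definition matching E :=
  (forall e, e \in E -> e.1 != e.2) /\
  (forall e e', e \in E -> e' \in E -> e != e' ->
     [disjoint [set e.1; e.2] & [set e'.1; e'.2]]).

Definition covered E : {set I} :=
  [set i | [exists e in E, i \in [set e.1; e.2]]].

Lemma matching_subset E F : F \subset E -> matching E -> matching F.
Proof.
move=> /fintype.subsetP FE [h1 h2]; split=> [e /FE /h1 //|e e' /FE eE /FE e'E].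
exact: h2.
Qed.

Lemma coveredP E i :
  reflect (exists2 e, e \in E & i \in [set e.1; e.2]) (i \in covered E).
Proof. by rewrite /covered finset.in_set; exact: exists_inP. Qed.

Lemma covered_endpoint E e i : e \in E -> i \in [set e.1; e.2] -> i \in covered E.
Proof. by move=> eE ie; apply/coveredP; exists e. Qed.

Lemma matching_endpoint E e e' i : matching E -> e \in E -> e' \in E ->
  i \in [set e.1; e.2] -> i \in [set e'.1; e'.2] -> e' = e.
Proof.
move=> [_ h] eE e'E ie ie'; apply/eqP/negP => /negP ne.
by have := disjointFr (h _ _ e'E eE ne) ie'; rewrite ie.
Qed.

(** Since edges are disjoint, no other edge touches an endpoint of [e]: deleting [e] frees exactly
    its two ends. *)
Lemma covered_setD1 E e i : matching E -> e \in E ->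
  (i \notin covered (E :\ e)) = (i \in [set e.1; e.2]) || (i \notin covered E).
Proof.
move=> mE eE; have [ie|ie] := boolP (i \in [set e.1; e.2]).
  apply/negP => /coveredP[e']; rewrite !in_setD1 => /andP[ne e'E] ie'.
  by rewrite (matching_endpoint mE eE e'E ie ie') eqxx in ne.
congr negb; apply/coveredP/coveredP => -[e' e'E ie'].
  by exists e' => //; move: e'E; rewrite in_setD1 => /andP[].
exists e' => //; rewrite in_setD1 e'E andbT.
by apply: contraNneq ie => <-.
Qed.

Lemma prod_uncovered_setD1 E e (phi : I -> R) : matching E -> e \in E ->
  \prod_(i | i \notin covered (E :\ e)) phi i =
  phi e.1 * phi e.2 * \prod_(i | i \notin covered E) phi i.
Proof.
move=> mE eE; have ne := mE.1 _ eE.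
have c1 : e.1 \in covered E by apply: (covered_endpoint eE); rewrite set21.
have c2 : e.2 \in covered E by apply: (covered_endpoint eE); rewrite set22.
rewrite (bigD1 e.1) ?covered_setD1 ?set21//= (bigD1 e.2) ?covered_setD1 ?set22//=; last first.
  by rewrite eq_sym.
rewrite mulrA; congr (_ * _); apply: eq_bigl => i.
rewrite covered_setD1// in_set2.
have [->|] := eqVneq i e.1; first by rewrite c1.
by have [->|] := eqVneq i e.2; rewrite ?c2 ?andbF ?andbT.
Qed.

(** Induction on the number of edges works because a matching minus an edge is again a matching. *)
Lemma matching_ind (P : {set I * I} -> Prop) :
  P finset.set0 ->
  (forall E e, matching E -> e \in E -> P (E :\ e) -> P E) ->
  forall E, matching E -> P E.
Proof.
move=> P0 PS E; have [n] := ubnP #|E|; elim: n E => // n IH E.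
have [->//|[e eE]] := set_0Vmem E.
rewrite (cardsD1 e) eE ltnS => le mE; apply: (PS _ e) => //.
by apply: IH => //; apply: matching_subset mE; apply: subD1set.
Qed.

Lemma covered0 : covered finset.set0 = finset.set0.
Proof. by apply/setP => i; rewrite finset.in_set0; apply/negP => /coveredP[e]; rewrite finset.in_set0. Qed.

Lemma prod_matching E (phi : I -> R) : matching E ->
  \prod_i phi i =
  \prod_(i | i \notin covered E) phi i * \prod_(e in E) (phi e.1 * phi e.2).
Proof.
move=> mE; elim/matching_ind: E / mE => [|E e mE eE ->].
  by rewrite big_set0 mulr1 covered0; apply: eq_bigl => i; rewrite finset.in_set0.
rewrite prod_uncovered_setD1// (big_setD1 e eE)/=.
by rewrite [in RHS]mulrCA !mulrA.
Qed.

(** An indicator absorbed into the factor of [i]. A sum restricted to [s i == a] thereby becomes a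
    full sum of a weight of the same form, so marginals are partition functions. *)
Definition pin i a f : I -> T -> R :=
  fun k c => if k == i then (c == a)%:R * f k c else f k c.

Lemma prod_pin i a f (s : {ffun I -> T}) :
  \prod_k pin i a f k (s k) = (s i == a)%:R * \prod_k f k (s k).
Proof.
rewrite (bigD1 i)//= [in RHS](bigD1 i)//= /pin eqxx mulrA; congr (_ * _).
by apply: eq_bigr => k /negPf ->.
Qed.

Lemma sum_delta (F : T -> R) a : \sum_c (c == a)%:R * F c = F a.
Proof.
rewrite (bigD1 a)//= eqxx mul1r big1 ?addr0// => c /negPf ->.
by rewrite mul0r.
Qed.

Lemma sum_pin i a f : \sum_c pin i a f i c = f i a.
Proof. by rewrite /pin eqxx sum_delta. Qed.

Lemma pin_neq i a f k : k != i -> pin i a f k = f k.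
Proof. by move=> /negPf ki; apply/funext => c; rewrite /pin ki. Qed.

(** The unnormalized density of a Markov random field with vertex potentials [f] and edge potentials
    [g]. *)
Definition weight E f g (s : {ffun I -> T}) :=
  (\prod_i f i (s i)) * \prod_(e in E) g e (s e.1) (s e.2).

Lemma weight_pin E f g i a s :
  weight E (pin i a f) g s = (s i == a)%:R * weight E f g s.
Proof. by rewrite /weight prod_pin mulrA. Qed.

(** The partition function of the connected component formed by [e] alone. *)
Definition edge_mass f g e :=
  \sum_a \sum_b f e.1 a * f e.2 b * g e a b.


Lemma edge_mass_pin f g e i a : i \notin [set e.1; e.2] ->
  edge_mass (pin i a f) g e = edge_mass f g e.
Proof.
rewrite in_set2 negb_or => /andP[i1 i2].
by rewrite /edge_mass !pin_neq 1?eq_sym.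
Qed.

Lemma other_edge_mass_pin E f g e i a : matching E -> e \in E ->
  i \in [set e.1; e.2] ->
  \prod_(e' in E :\ e) edge_mass (pin i a f) g e' =
  \prod_(e' in E :\ e) edge_mass f g e'.
Proof.
move=> mE eE ie; apply: eq_bigr => e'; rewrite in_setD1 => /andP[ne e'E].
rewrite edge_mass_pin//; apply: contra ne => ie'.
by rewrite (matching_endpoint mE eE e'E ie ie').
Qed.

(* Pinning both ends of an edge removes it from the matching and frees the
   rest of the sum from the values of these two coordinates. *)
Lemma sum_weight E f g : matching E ->
  \sum_s weight E f g s =
  (\prod_(i | i \notin covered E) \sum_a f i a) * \prod_(e in E) edge_mass f g e.
Proof.
(* [f] stays general because the induction hypothesis is applied to pinned factors. *)
move=> mE; elim/matching_ind: E / mE f => [|E e mE eE IH] f.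
  under [LHS]eq_bigr do rewrite /weight big_set0 mulr1.
  rewrite -bigA_distr_bigA big_set0 mulr1 covered0.
  by apply: eq_bigl => i; rewrite finset.in_set0.
have ne := mE.1 _ eE.
transitivity (\sum_a \sum_b g e a b *
    \sum_s weight (E :\ e) (pin e.1 a (pin e.2 b f)) g s).
  under [RHS]eq_bigr do under eq_bigr do rewrite big_distrr/=.
  under [RHS]eq_bigr do rewrite exchange_big/=.
  rewrite exchange_big/=; apply: eq_bigr => s _.
  (* Both endpoint values are summed over, with indicators that keep only the actual ones. *)
  transitivity (\sum_a (a == s e.1)%:R * \sum_b (b == s e.2)%:R *
      (g e a b * weight (E :\ e) f g s)).
    rewrite sum_delta sum_delta /weight (big_setD1 e eE)/=.
    by rewrite mulrCA !mulrA.
  apply: eq_bigr => a _; rewrite big_distrr/=; apply: eq_bigr => b _.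
  by rewrite !weight_pin [a == _]eq_sym [b == _]eq_sym; ring.
transitivity (\sum_a \sum_b f e.1 a * f e.2 b * g e a b *
    ((\prod_(i | i \notin covered E) \sum_c f i c) *
     \prod_(e' in E :\ e) edge_mass f g e')).
  apply: eq_bigr => a _; apply: eq_bigr => b _; rewrite IH prod_uncovered_setD1//.
  rewrite !(other_edge_mass_pin _ _ _ mE eE) ?set21 ?set22//.
  rewrite sum_pin [pin e.1 _ _ e.2]pin_neq 1?eq_sym// sum_pin pin_neq//.
  rewrite (eq_bigr (fun i => \sum_c f i c)) => [|i iV]; first by ring.
  rewrite !pin_neq//; apply: contraNneq iV => ->;
  by apply: (covered_endpoint eE); rewrite ?set21 ?set22.
under [LHS]eq_bigr do rewrite -big_distrl/=.
by rewrite -big_distrl/= -/(edge_mass f g e) (big_setD1 e eE)/= mulrCA.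
Qed.

(** Pinning an uncovered vertex replaces its own factor [\sum_c f i c] of the partition function by
    [f i a] and changes nothing else. The cross-multiplied form avoids dividing by a sum that could
    vanish. *)
Lemma sum_weight_vertex E f g i a : matching E -> i \notin covered E ->
  (\sum_(s : {ffun I -> T} | s i == a) weight E f g s) * (\sum_c f i c) =
  f i a * \sum_s weight E f g s.
Proof.
move=> mE iE.
have -> : \sum_(s : {ffun I -> T} | s i == a) weight E f g s =
          \sum_s weight E (pin i a f) g s.
  rewrite big_mkcond; apply: eq_bigr => s _; rewrite weight_pin.
  by case: eqP; rewrite ?mul1r ?mul0r.
rewrite !sum_weight// (bigD1 i)//= [in RHS](bigD1 i)//= sum_pin.
under eq_bigr => k /andP[_ ki] do rewrite pin_neq//.
under [X in _ * X * _]eq_bigr => e eE.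
  rewrite edge_mass_pin; last by apply: contra iE; apply: covered_endpoint.
  over.
by ring.
Qed.

(** Pinning both ends of [e] affects only the factor [edge_mass f g e] of the partition function. *)
Lemma sum_weight_edge E f g e a b : matching E -> e \in E ->
  (\sum_(s : {ffun I -> T} | (s e.1 == a) && (s e.2 == b)) weight E f g s) * edge_mass f g e =
  f e.1 a * f e.2 b * g e a b * \sum_s weight E f g s.
Proof.
move=> mE eE; have ne := mE.1 _ eE.
set h := pin e.1 a (pin e.2 b f).
have -> : \sum_(s : {ffun I -> T} | (s e.1 == a) && (s e.2 == b)) weight E f g s =
          \sum_s weight E h g s.
  rewrite big_mkcond; apply: eq_bigr => s _; rewrite !weight_pin.
  by do 2!case: eqP; rewrite ?mul1r ?mul0r.
rewrite !sum_weight// (big_setD1 e eE) [\prod_(e0 in E) _](big_setD1 e eE)/=.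
rewrite /h !(other_edge_mass_pin _ _ _ mE eE) ?set21 ?set22//.
have -> : edge_mass (pin e.1 a (pin e.2 b f)) g e = f e.1 a * f e.2 b * g e a b.
  transitivity (\sum_a' (a' == a)%:R * \sum_b' (b' == b)%:R *
      (f e.1 a' * f e.2 b' * g e a' b')); last by rewrite !sum_delta.
  rewrite /edge_mass; apply: eq_bigr => a' _; rewrite big_distrr/=.
  apply: eq_bigr => b' _.
  by rewrite /h /pin !eqxx [e.2 == _]eq_sym (negPf ne); ring.
rewrite (eq_bigr (fun i => \sum_c f i c)) => [|i iV]; first by ring.
rewrite /h !pin_neq//; apply: contraNneq iV => ->;
by apply: (covered_endpoint eE); rewrite ?set21 ?set22.
Qed.

Lemma weight_factorization E f g (s : {ffun I -> T}) : matching E ->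
  (forall i a, 0 < f i a) -> (forall e a b, 0 < g e a b) ->
  let P (A : pred {ffun I -> T}) :=
    (\sum_(t | A t) weight E f g t) / \sum_t weight E f g t in
  weight E f g s / \sum_t weight E f g t =
  (\prod_(i | i \notin covered E) P (fun t => t i == s i)) *
  \prod_(e in E) P (fun t => (t e.1 == s e.1) && (t e.2 == s e.2)).
Proof.
move=> mE f0 g0 P.
have w0 t : 0 < weight E f g t by rewrite mulr_gt0// prodr_gt0.
have sf0 i : 0 < \sum_c f i c.
  by rewrite (bigD1 (s i))//= ltr_wpDr// sumr_ge0// => c _; rewrite ltW.
have sg0 e : 0 < edge_mass f g e.
  rewrite /edge_mass (bigD1 (s e.1))//= ltr_wpDr//.
    by apply: sumr_ge0 => c _; apply: sumr_ge0 => b _; rewrite ltW// !mulr_gt0.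
  rewrite (bigD1 (s e.1))//= ltr_wpDr ?mulr_gt0//.
  by apply: sumr_ge0 => c _; rewrite ltW// !mulr_gt0.
have Z0 : 0 < \sum_t weight E f g t.
  by rewrite (bigD1 s)//= ltr_wpDr// sumr_ge0// => t _; rewrite ltW.
have P1 i : i \notin covered E -> P (fun t => t i == s i) = f i (s i) / \sum_c f i c.
  move=> iE; apply/eqP; rewrite /P/= eqr_div ?(gt_eqF Z0) ?(gt_eqF (sf0 _))//.
  by rewrite sum_weight_vertex.
have P2 e : e \in E -> P (fun t => (t e.1 == s e.1) && (t e.2 == s e.2)) =
    f e.1 (s e.1) * f e.2 (s e.2) * g e (s e.1) (s e.2) / edge_mass f g e.
  move=> eE; apply/eqP; rewrite /P/= eqr_div ?(gt_eqF Z0) ?(gt_eqF (sg0 _))//.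
  by rewrite sum_weight_edge.
rewrite (eq_bigr _ P1) [X in _ = _ * X](eq_bigr _ P2).
rewrite !prodf_div/= mulf_div -sum_weight//; congr (_ / _).
(* The vertex factors at uncovered vertices and at edge ends recombine into the product over all
   vertices. *)
by rewrite [in RHS]big_split/= mulrA -prod_matching.
Qed.

End PairwiseModel.

(** * Logarithms of products and the Gibbs inequality *)

Lemma ln_prod {R : realType} {I : Type} (r : seq I) (P : pred I) (F : I -> R) :
  (forall i, 0 < F i) ->
  ln (\prod_(i <- r | P i) F i) = \sum_(i <- r | P i) ln (F i).
Proof.
move=> F0; apply: expR_inj; rewrite expR_sum lnK; last by rewrite posrE prodr_gt0.
by apply: eq_bigr => i _; rewrite lnK// posrE.
Qed.

(* ln x <= x - 1 at x = q / p gives p ln (p / q) >= p - q. *)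
Lemma gibbs {R : realType} {T : finType} (p q : T -> R) :
  (forall a, 0 < p a) -> (forall a, 0 < q a) ->
  \sum_a p a = \sum_a q a -> 0 <= \sum_a p a * ln (p a / q a).
Proof.
move=> p0 q0 pq; apply: (@le_trans _ _ (\sum_a (p a - q a))).
  by rewrite sumrB pq subrr.
apply: ler_sum => a _.
have qp0 : 0 < q a / p a by rewrite divr_gt0.
have : ln (q a / p a) <= q a / p a - 1.
  rewrite -{1}(subrK 1 (q a / p a)) addrC; apply: le_ln1Dx.
  by rewrite ltrBrDl subrr.
move/(ler_wpM2l (ltW (p0 a))).
rewrite mulrBr mulr1 mulrCA divff ?gt_eqF// mulr1.
by rewrite !ln_div ?posrE//; lra.
Qed.

(** * The Ising model conditioned on the label *)

Section Ising.
Context {R : realType} {m : nat}.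
Variables (thY : R) (th : 'I_m -> R) (th2 : 'I_m -> 'I_m -> R).
Variable E : {set 'I_m * 'I_m}.
Hypothesis mE : matching E.
Implicit Types (y a b : bool) (s : SV m) (i j : 'I_m).

Local Notation w := (ising_weight thY th th2 E).
Local Notation Z := (ising_Z thY th th2 E).
Local Notation PJ := (PJ thY th th2 E).
Local Notation PY := (PY thY th th2 E).
Local Notation Plam := (Plam thY th th2 E).
Local Notation P1 := (Pcond1 thY th th2 E).
Local Notation P2 := (Pcond2 thY th th2 E).

Lemma PJ_gt0 y s : 0 < PJ y s.
Proof.
have w0 y' s' : 0 < w y' s' by exact: expR_gt0.
by rewrite divr_gt0// (@sumr_gt0 _ _ _ _ y)// => y'; rewrite (@sumr_gt0 _ _ _ _ s).
Qed.

Lemma PY_gt0 y : 0 < PY y.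
Proof. by rewrite (@sumr_gt0 _ _ _ _ [ffun=> true])// => s; exact: PJ_gt0. Qed.

Lemma Plam_gt0 s : 0 < Plam s.
Proof. by rewrite (@sumr_gt0 _ _ _ _ true)// => y; exact: PJ_gt0. Qed.

Lemma Pcond1_gt0 i y a : 0 < P1 i y a.
Proof.
rewrite divr_gt0 ?PY_gt0// (@sumr_gt0 _ _ _ _ [ffun=> a]) ?ffunE// => s.
exact: PJ_gt0.
Qed.

Lemma Pcond2_gt0 i j y s : 0 < P2 i j y (s i) (s j).
Proof.
rewrite divr_gt0 ?PY_gt0// (@sumr_gt0 _ _ _ _ s) ?eqxx// => s'.
exact: PJ_gt0.
Qed.

(** Grouping the configurations by the value at [i] turns an average over the joint law into one
    over the marginal; this produces the sums in [KL_src]. *)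
Lemma sum_PJ_source i y (phi : bool -> R) :
  \sum_s PJ y s * phi (s i) = PY y * \sum_a P1 i y a * phi a.
Proof.
rewrite (partition_big (fun s => s i) xpredT)//= big_distrr/=.
apply: eq_bigr => a _; rewrite mulrA mulrCA divff ?gt_eqF ?PY_gt0// mulr1.
by rewrite big_distrl/=; apply: eq_bigr => s /eqP ->.
Qed.

Lemma sum_PJ_pair i j y (phi : bool -> bool -> R) :
  \sum_s PJ y s * phi (s i) (s j) =
  PY y * \sum_a \sum_b P2 i j y a b * phi a b.
Proof.
rewrite (partition_big (fun s => s i) xpredT)//= big_distrr/=.
apply: eq_bigr => a _; rewrite (partition_big (fun s => s j) xpredT)//=.
rewrite big_distrr/=; apply: eq_bigr => b _.
rewrite mulrA mulrCA divff ?gt_eqF ?PY_gt0// mulr1.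
by rewrite big_distrl/=; apply: eq_bigr => s /andP[/eqP -> /eqP ->].
Qed.

Lemma sum_Pcond1 i y : \sum_a P1 i y a = 1.
Proof.
have := sum_PJ_source i y (fun=> 1).
under eq_bigr do rewrite mulr1.
under [in RHS]eq_bigr do rewrite mulr1.
rewrite -[LHS]/(PY y) -[X in X = _ -> _]mulr1 => /mulfI -> //.
by rewrite gt_eqF ?PY_gt0.
Qed.

(** For fixed [y] the label term is a constant and the label-source interaction is a vertex
    potential, so the general factorization applies. *)
Lemma ising_weightE y s :
  w y s = expR (thY * sg y) *
    weight E (fun i a => expR (th i * sg a * sg y))
             (fun e a b => expR (th2 e.1 e.2 * sg a * sg b)) s.
Proof. by rewrite /ising_weight !expRD !expR_sum -mulrA. Qed.

(** In this form the logarithm yields a sum over all sources plus, for each edge, the pointwise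
    conditional mutual information. *)
Lemma PJ_cond_factorization y s :
  PJ y s / PY y =
  (\prod_i P1 i y (s i)) *
  \prod_(e in E) (P2 e.1 e.2 y (s e.1) (s e.2) /
                  (P1 e.1 y (s e.1) * P1 e.2 y (s e.2))).
Proof.
set f := fun i a => expR (th i * sg a * sg y).
set g := fun e a b => expR (th2 e.1 e.2 * sg a * sg b) : R.
(* Everything independent of the configuration goes into [c], which cancels in probabilities
   conditional on [y]. *)
set c := expR (thY * sg y) / Z.
have PJE t : PJ y t = c * weight E f g t.
  by rewrite /Defs.PJ ising_weightE mulrAC.
have c0 : c != 0.
  have := PJ_gt0 y s; rewrite PJE; apply: contraTneq => ->.
  by rewrite mul0r ltxx.
have condE (A : pred (SV m)) : (\sum_(t | A t) PJ y t) / PY y =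
    (\sum_(t | A t) weight E f g t) / \sum_t weight E f g t.
  rewrite /Defs.PY; under eq_bigr do rewrite PJE.
  under [X in _ / X = _]eq_bigr do rewrite PJE.
  by rewrite -!big_distrr/= -mulf_div divff// mul1r.
have -> : PJ y s / PY y = weight E f g s / \sum_t weight E f g t.
  by have := condE (pred1 s); rewrite !big_pred1_eq.
rewrite weight_factorization//; [|by move=> *; exact: expR_gt0..].
(* The marginals at the two ends of each edge cancel the denominator of its correction factor. *)
rewrite (prod_matching _ mE) -mulrA -big_split/=; congr (_ * _).
  by apply: eq_bigr => i _; rewrite -condE.
apply: eq_bigr => e _; rewrite [RHS]mulrC divfK.
  by rewrite -condE.
by rewrite gt_eqF//; apply: mulr_gt0; exact: Pcond1_gt0.
Qed.

(** * The loss for fixed estimates, pointwise and averaged *)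

Variables (Q : 'I_m -> bool -> bool -> R) (Ph : SV m -> R).
Hypothesis Q_gt0 : forall i y a, 0 < Q i y a.
Hypothesis Ph_gt0 : forall s, 0 < Ph s.

Lemma xent_lossE y s : xent_loss thY th th2 E Q Ph y s =
  - ln (PJ y s / Plam s) - ln (Plam s / Ph s)
  + \sum_(e in E) ln (P2 e.1 e.2 y (s e.1) (s e.2) /
                      (P1 e.1 y (s e.1) * P1 e.2 y (s e.2)))
  + \sum_i ln (P1 i y (s i) / Q i y (s i)).
Proof.
have -> : xent_loss thY th th2 E Q Ph y s = - ln (Ptil_post thY th th2 E Q Ph y s).
  (* Of the two coefficients [(1 + sg y) / 2] and [(1 - sg y) / 2], one is 1 and the other 0. *)
  by rewrite /xent_loss; case: y; rewrite /sg; lra.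
have lnJ : ln (PJ y s) - ln (PY y) = \sum_i ln (P1 i y (s i)) +
    \sum_(e in E) ln (P2 e.1 e.2 y (s e.1) (s e.2) /
                      (P1 e.1 y (s e.1) * P1 e.2 y (s e.2))).
  have t0 e : 0 < P2 e.1 e.2 y (s e.1) (s e.2) /
                      (P1 e.1 y (s e.1) * P1 e.2 y (s e.2)).
    by apply: divr_gt0; [|apply: mulr_gt0]; [exact: Pcond2_gt0|exact: Pcond1_gt0..].
  rewrite -ln_div ?posrE ?PJ_gt0 ?PY_gt0// PJ_cond_factorization.
  rewrite lnM ?posrE ?prodr_gt0// => [|i _]; last exact: Pcond1_gt0.
  by rewrite !ln_prod// => i; exact: Pcond1_gt0.
have -> : \sum_i ln (P1 i y (s i) / Q i y (s i)) =
    \sum_i ln (P1 i y (s i)) - \sum_i ln (Q i y (s i)).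
  by rewrite -sumrB; apply: eq_bigr => i _; rewrite ln_div ?posrE ?Pcond1_gt0.
have Qp : 0 < \prod_(i < m) Q i y (s i) by rewrite prodr_gt0.
rewrite /Ptil_post ln_div ?posrE ?mulr_gt0 ?PY_gt0//.
rewrite lnM ?posrE ?PY_gt0// ln_prod//.
rewrite [ln (PJ y s / _)]ln_div ?posrE ?PJ_gt0 ?Plam_gt0//.
rewrite [ln (Plam s / _)]ln_div ?posrE ?Plam_gt0//.
(* All logarithms are now split, so the claim is linear in them; [ln (Plam s)] enters twice and
   cancels. *)
by move: lnJ; set A := \sum_(e in E) _; lra.
Qed.

Lemma exp_lossE : exp_loss thY th th2 E Q Ph =
  condH thY th th2 E + \sum_(e in E) condMI thY th th2 E e.1 e.2
  - KL_lam thY th th2 E Ph + \sum_i KL_src thY th th2 E Q i.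
Proof.
rewrite /exp_loss.
under eq_bigr do under eq_bigr do rewrite xent_lossE 2!mulrDr mulrBr mulrN.
under eq_bigr do rewrite 2!big_split/= sumrB sumrN.
rewrite 2!big_split/= sumrB sumrN /condH.
have -> : \sum_y \sum_s PJ y s * ln (Plam s / Ph s) = KL_lam thY th th2 E Ph.
  rewrite exchange_big/=; apply: eq_bigr => s _.
  by rewrite -big_distrl.
have -> : \sum_y \sum_s PJ y s * \sum_i ln (P1 i y (s i) / Q i y (s i)) =
    \sum_i KL_src thY th th2 E Q i.
  rewrite [RHS]exchange_big/=; apply: eq_bigr => y _.
  under eq_bigr do rewrite big_distrr/=.
  rewrite exchange_big/=; apply: eq_bigr => i _.
  exact: (sum_PJ_source i y (fun a => ln (P1 i y a / Q i y a))).
have -> : \sum_y \sum_s PJ y s * \sum_(e in E)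
      ln (P2 e.1 e.2 y (s e.1) (s e.2) /
          (P1 e.1 y (s e.1) * P1 e.2 y (s e.2))) =
    \sum_(e in E) condMI thY th th2 E e.1 e.2.
  rewrite [RHS]exchange_big/=; apply: eq_bigr => y _.
  under eq_bigr do rewrite big_distrr/=.
  rewrite exchange_big/=; apply: eq_bigr => e _.
  exact: (sum_PJ_pair e.1 e.2 y
    (fun a b => ln (P2 e.1 e.2 y a b / (P1 e.1 y a * P1 e.2 y b)))).
by congr (_ + _); rewrite addrAC.
Qed.

(** The Gibbs inequality holds for each label separately. Nonnegativity gives the source terms an
    expectation in the extended reals. *)
Lemma KL_src_ge0 i : (forall y, Q i y true + Q i y false = 1) ->
  0 <= KL_src thY th th2 E Q i.
Proof.
move=> Q1; apply: sumr_ge0 => y _; rewrite mulr_ge0 ?(ltW (PY_gt0 _))//.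
apply: gibbs => // [a|]; first exact: Pcond1_gt0.
by rewrite sum_Pcond1 big_bool/= Q1.
Qed.

End Ising.

Local Open Scope classical_set_scope.

(** * Integrals of finitely valued and of nonnegative functions *)

Section Expectation.
Context {d : measure_display} {Omega : measurableType d} {R : realType}.
Variable Pr : probability Omega R.

Lemma measurable_fun_finite_comp (T : finType) (X : Omega -> T) (F : T -> R) :
  (forall t, measurable (X @^-1` [set t])) -> measurable_fun setT (F \o X).
Proof.
move=> mX _ B _; rewrite setTI.
have -> : (F \o X) @^-1` B = \bigcup_(t in F @^-1` B) (X @^-1` [set t]).
  by apply/seteqP; split => w /= => [Bw|[t Bt ->//]]; exists (X w).
by apply: fin_bigcup_measurable => //; exact: finite_finset.
Qed.

Lemma integrable_finite_comp (T : finType) (X : Omega -> T) (F : T -> R) :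
  (forall t, measurable (X @^-1` [set t])) ->
  Pr.-integrable setT (fun w => (F (X w))%:E).
Proof.
move=> mX; apply: (@le_integrable _ _ _ Pr _ measurableT _
    (* A constant bounding every value of [F]; it is integrable since the total mass is finite. *)
    (EFin \o cst (\sum_t `|F t|))).
- by apply/measurable_EFinP; exact: measurable_fun_finite_comp.
- move=> w _ /=; rewrite lee_fin [leRHS]ger0_norm ?sumr_ge0//.
  by rewrite (bigD1 (X w))//= lerDl sumr_ge0.
- exact: finite_measure_integrable_cst.
Qed.

Local Open Scope ereal_scope.

(** If [g] has finite integral, this is ordinary linearity. Otherwise both sides are [+oo]: the
    negative part of [f + g] has finite integral and the positive part does not. *)
Lemma integralD_ge0r (f g : Omega -> R) :
  Pr.-integrable setT (EFin \o f) -> measurable_fun setT g ->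
  (forall w, (0 <= g w)%R) ->
  \int[Pr]_w (f w + g w)%:E = \int[Pr]_w (f w)%:E + \int[Pr]_w (g w)%:E.
Proof.
move=> fi mg g0.
have mEg : measurable_fun setT (EFin \o g) by exact/measurable_EFinP.
have ig0 : 0 <= \int[Pr]_w (g w)%:E by apply: integral_ge0 => w _; rewrite lee_fin.
have [gfin|] := ltP (\int[Pr]_w (g w)%:E) +oo.
  under eq_integral do rewrite EFinD.
  rewrite (@integralD _ _ _ Pr _ measurableT (EFin \o f) (EFin \o g))//.
  apply/integrableP; split => //.
  by under eq_integral do rewrite /= ger0_norm//.
rewrite leye_eq => /eqP ginf; rewrite ginf addey; last first.
  by have := integrable_fin_num measurableT fi; rewrite fin_numE => /andP[].
set h := fun w => (f w + g w)%:E.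
have mEf : measurable_fun setT (EFin \o f) by case/integrableP: fi.
have mh : measurable_fun setT h.
  by apply/measurable_EFinP; apply: measurable_funD; exact/measurable_EFinP.
have fabs : \int[Pr]_w `|(f w)%:E| < +oo by case/integrableP: fi.
have mabs : measurable_fun setT (fun w => `|(f w)%:E|).
  exact: measurableT_comp.
(* As [g] is nonnegative, the negative part is at most [|f|]. *)
have hneg : \int[Pr]_w h^\- w < +oo.
  apply: le_lt_trans fabs; apply: ge0_le_integral => //.
    exact: measurable_funeneg.
  move=> w _; rewrite funenegE ge_max abse_ge0 andbT /h /= lee_fin.
  have := ler_norm (- f w)%R; rewrite normrN; have := g0 w; lra.
(* Since [g] is at most the positive part of [f + g] plus [|f|], a finite integral here would make
   that of [g] finite. *)
have hpos : \int[Pr]_w h^\+ w = +oo.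
  apply/eqP; rewrite -leye_eq leNgt; apply/negP => hfin.
  have : \int[Pr]_w (g w)%:E <= \int[Pr]_w h^\+ w + \int[Pr]_w `|(f w)%:E|.
    have mhp : measurable_fun setT h^\+ by exact: measurable_funepos.
    rewrite -ge0_integralD//; apply: ge0_le_integral => //.
    - by move=> w _; rewrite lee_fin.
    - exact: emeasurable_funD.
    move=> w _; apply: (@le_trans _ _ (h w + `|(f w)%:E|)).
      rewrite /h /= -EFinD lee_fin.
      by have := ler_norm (- f w)%R; rewrite normrN; lra.
    by rewrite leeD2r// funeposE le_max lexx.
  by rewrite ginf leye_eq; apply/negP; rewrite lt_eqF// lte_add_pinfty.
rewrite [LHS]integralE hpos addye//.
by rewrite eqe_oppLR lt_eqF.
Qed.

Lemma measurable_KL_src (m : nat) (thY : R) (th : 'I_m -> R)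
    (th2 : 'I_m -> 'I_m -> R) (E : {set 'I_m * 'I_m})
    (Q : Omega -> 'I_m -> bool -> bool -> R) (i : 'I_m) :
  matching E ->
  (forall y a, measurable_fun setT (fun w => Q w i y a)) ->
  (forall w y a, (0 < Q w i y a)%R) ->
  measurable_fun setT (fun w => KL_src thY th th2 E (Q w) i).
Proof.
move=> mE mQ Q0; apply: measurable_sum => y.
apply: measurable_funM; first exact: measurable_cst.
apply: measurable_sum => a.
apply: measurable_funM; first exact: measurable_cst.
(* By positivity the logarithm of the ratio splits, and only [ln (Q w i y a)] depends on [w]. *)
under eq_fun do rewrite ln_div ?posrE ?Pcond1_gt0//.
apply: measurable_funB; first exact: measurable_cst.
exact: (measurableT_comp (@measurable_ln R)).
Qed.

End Expectation.

(** * The expected generalization error *)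

Local Open Scope ring_scope.

(** The disjointness assumed here is that of classical sets, whereas [matching] uses that of finite
    sets; the proof passes from one to the other. *)
Lemma disjoint_edges_matching (m : nat) (E : {set 'I_m * 'I_m}) :
  (forall e, e \in E -> (e.1 < e.2)%N) ->
  (forall e e', e \in E -> e' \in E -> e != e' ->
     [disjoint [set e.1; e.2] & [set e'.1; e'.2]]) ->
  matching E.
Proof.
move=> lt12 dis; split=> [e /lt12|e e' eE e'E ne]; first by rewrite ltn_neqAle => /andP[].
apply/pred0P => i /=; apply/negP => /andP[].
rewrite !in_set2 => /orP i1 /orP i2.
have := dis e e' eE e'E ne; rewrite /disj_set => /eqP/seteqP[/(_ i) + _]; apply.
by split => /=; [case: i1|case: i2] => /eqP; [left|right|left|right].
Qed.

Theorem theorem1 (R : realType) (m : nat)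
  (thY : R) (th : 'I_m -> R) (th2 : 'I_m -> 'I_m -> R) (E : {set 'I_m * 'I_m})
  (hthY : 0 <= thY) (hth : forall i, 0 <= th i)
  (hth2 : forall e, e \in E -> 0 <= th2 e.1 e.2)
  (hE1 : forall e, e \in E -> (e.1 < e.2)%N)
  (hE2 : forall e e', e \in E -> e' \in E -> e != e' ->
     [disjoint [set e.1; e.2] & [set e'.1; e'.2]])
  (d : measure_display) (Omega : measurableType d) (Pr : probability Omega R)
  (n : nat) (hn : (0 < n)%N)
  (data : Omega -> n.-tuple (SV m))
  (hdata : forall t, measurable (data @^-1` [set t]))
  (Ptil : Omega -> 'I_m -> bool -> bool -> R)
  (hPtilm : forall i y a, measurable_fun setT (fun w => Ptil w i y a))
  (hPtil_pos : forall w i y a, 0 < Ptil w i y a)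
  (hPtil_sum : forall w i y, Ptil w i y true + Ptil w i y false = 1)
  (hPhat_pos : forall w s, 0 < Phat R (data w) s) :
  (\int[Pr]_w (exp_loss thY th th2 E (Ptil w) (Phat R (data w)))%:E
   = (condH thY th th2 E + \sum_(e in E) condMI thY th th2 E e.1 e.2)%:E
     - \int[Pr]_w (KL_lam thY th th2 E (Phat R (data w)))%:E
     + \sum_(i < m) \int[Pr]_w (KL_src thY th th2 E (Ptil w) i)%:E)%E.
Proof.
have mE := disjoint_edges_matching hE1 hE2.
set C := condH thY th th2 E + \sum_(e in E) condMI thY th th2 E e.1 e.2.
set K := KL_lam thY th th2 E; set S := fun i w => KL_src thY th th2 E (Ptil w) i.
have intK : Pr.-integrable setT (fun w => (K (Phat R (data w)))%:E).
  (* The data range over the finite type of tuples of source vectors. *)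
  exact: (integrable_finite_comp Pr _ data (fun t => K (Phat R t))).
have intC : Pr.-integrable setT (EFin \o cst C).
  exact: finite_measure_integrable_cst.
have intCK : Pr.-integrable setT (EFin \o (fun w => C - K (Phat R (data w)))).
  exact: (integrableB measurableT intC intK).
have S0 i w : 0 <= S i w by apply: KL_src_ge0.
have mS i : measurable_fun setT (S i) by exact: measurable_KL_src.
under eq_integral do rewrite (exp_lossE _ _ _ mE)//.
rewrite (@integralD_ge0r _ _ _ Pr (fun w => C - K (Phat R (data w)))
  (fun w => \sum_i S i w) intCK); last 2 first.
- exact: measurable_sum.
- by move=> w; exact: sumr_ge0.
congr (_ + _)%E.
  (* The constant is its own expectation, the total mass being 1. *)
  rewrite -[C%:E]mule1 -(@probability_setT _ _ _ Pr) -integral_cst//.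
  exact: (integralB measurableT intC intK).
under eq_integral do rewrite -sumEFin.
(* Nonnegativity allows exchanging sum and integral even when some integrals are infinite. *)
rewrite ge0_integral_sum// => i.
  exact/measurable_EFinP.
by move=> w _; rewrite lee_fin.
Qed.
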